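(* Let $\mu$ be a dominant minuscule coweight of $\Phi$, and let $(W,S)$ be the finite Weyl group of $\Phi$ inside the affine Weyl group $(W_{\mathrm{aff}},S_{\mathrm{aff}})$. Let $T$ be the set of reflections in $W$. Consider a $\mu$-admissible element $w\le t_{\lambda(w)}$ of $\widetilde W$. There exists a length-zero element $\sigma\in\widetilde W$ such that $w,t_{\lambda(w)}\in\sigma W_{\mathrm{aff}}$. Let $w\stackrel{\Delta}{\longrightarrow}t_{\lambda(w)}$ be any path in the Bruhat graph. Then each reflection in the edge set $E(\Delta)=\{t_1,\dots,t_n\}$ belongs to $T$.
   Context: $\Phi$ is a (reduced, crystallographic) root system with chosen positive roots $\Phi^+$, finite Weyl group $W$ and coweight lattice $Y$. A coweight $\lambda$ is dominant if $\langle\lambda,\alpha\rangle\ge0$ for all $\alpha\in\Phi^+$ and minuscule if $\langle\lambda,\alpha\rangle\in\{-1,0,1\}$ for all $\alpha\in\Phi$. $\widetilde W=Y\rtimes W$ is the extended affine Weyl group; $t_\lambda$ denotes translation by $\lambda\in Y$, and each $w\in\widetilde W$ is written $w=t_{\lambda(w)}\bar w$ with $\lambda(w)\in Y$, $\bar w\in W$. The base alcove $\mathcal C$ is the alcove in the dominant chamber whose closure contains the origin; $W_{\mathrm{aff}}$ is the Coxeter group generated by the set $S_{\mathrm{aff}}$ of reflections in the walls of $\mathcal C$, and $\widetilde W=W_{\mathrm{aff}}\rtimes\Omega$, where $\Omega$ is the stabilizer of $\mathcal C$. The length function and Bruhat order of $W_{\mathrm{aff}}$ extend to $\widetilde W$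 so that $\Omega$ is the set of length-zero elements, and $\sigma u\le\sigma' u'$ ($\sigma,\sigma'\in\Omega$, $u,u'\in W_{\mathrm{aff}}$) iff $\sigma=\sigma'$ and $u\le u'$. An element $w\in\widetilde W$ is $\mu$-admissible if $w\le t_\eta$ for some $\eta$ in the $W$-orbit of $\mu$; for minuscule $\mu$ such $w$ satisfies $w\le t_{\lambda(w)}$. The Bruhat graph $\Omega_{(W_{\mathrm{aff}},S_{\mathrm{aff}})}$ has a directed edge $u\to ut$ for each reflection $t\in W_{\mathrm{aff}}$ (conjugate of an element of $S_{\mathrm{aff}}$) with $\ell(u)<\ell(ut)$. A path from $w$ to $t_{\lambda(w)}$ means a directed path from $\sigma^{-1}w$ to $\sigma^{-1}t_{\lambda(w)}$ in this graph, equivalently a sequence of affine reflections $t_1,\dots,t_n$ with $w<wt_1<wt_1t_2<\dots<wt_1\cdots t_n=t_{\lambda(w)}$; its edge set is $E(\Delta)=\{t_1,\dots,t_n\}$. *)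

(* Defs.v *)
From HB Require Import structures.
From mathcomp Require Import all_boot all_order all_algebra finmap.
From mathcomp Require Import all_classical all_reals all_analysis.
Import Order.TTheory GRing.Theory Num.Theory.
Import numFieldNormedType.Exports.

Set Implicit Arguments.
Unset Strict Implicit.
Unset Printing Implicit Defensive.

Local Open Scope classical_set_scope.
Local Open Scope ring_scope.

(* The ambient space is the Euclidean space R^n of column vectors.  The inner
   product identifies it with its dual, so that roots and coweights live in the
   same space and the pairing <lambda, alpha> is the inner product. *)
Definition dot (R : realType) (n : nat) (u v : 'cV[R]_n) : R :=
  \sum_i u i 0 * v i 0.

Definition coroot (R : realType) (n : nat) (a : 'cV[R]_n) : 'cV[R]_n :=
  (2 / dot a a) *: a.

(* The matrix of x |-> x - <x, a> a^vee. *)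
Definition refl (R : realType) (n : nat) (a : 'cV[R]_n) : 'M[R]_n :=
  1%:M - coroot a *m a^T.

Definition root_system (R : realType) (n : nat) (Phi : {fset 'cV[R]_n}) :=
  [/\ <<Phi>>%VS = fullv,
      0 \notin Phi,
      {in Phi &, forall a b, refl a *m b \in Phi},
      {in Phi &, forall a b, dot b (coroot a) \is a Num.int} &
      {in Phi, forall a (c : R), c *: a \in Phi -> c = 1 \/ c = -1}].

Definition positive_roots (R : realType) (n : nat)
    (Phi PhiP : {fset 'cV[R]_n}) :=
  [/\ {subset PhiP <= Phi},
      {in Phi, forall a, (a \in PhiP) (+) (- a \in PhiP)} &
      {in PhiP &, forall a b, a + b \in Phi -> a + b \in PhiP}].

Definition coweight (R : realType) (n : nat) (Phi : {fset 'cV[R]_n})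
    (lam : 'cV[R]_n) :=
  {in Phi, forall a, dot lam a \is a Num.int}.

Definition dominant (R : realType) (n : nat) (PhiP : {fset 'cV[R]_n})
    (lam : 'cV[R]_n) :=
  {in PhiP, forall a, 0 <= dot lam a}.

Definition minuscule (R : realType) (n : nat) (Phi : {fset 'cV[R]_n})
    (lam : 'cV[R]_n) :=
  {in Phi, forall a, dot lam a \in [:: -1; 0; 1]}.

Definition weyl (R : realType) (n : nat) (Phi : {fset 'cV[R]_n}) :
    set 'M[R]_n :=
  [set A | exists2 s : seq 'cV[R]_n, {subset s <= Phi} &
             A = \big[mulmx/1%:M]_(a <- s) refl a].

(* The pair (lam, A) stands for t_lam A, i.e. the affine map
   x |-> A x + lam.  Thus for w in the extended affine Weyl group, w.1 is
   lambda(w) and w.2 is the finite part of w. *)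
Definition aff (R : realType) (n : nat) := ('cV[R]_n * 'M[R]_n)%type.

Definition act (R : realType) (n : nat) (w : aff R n) (x : 'cV[R]_n) :
    'cV[R]_n :=
  w.2 *m x + w.1.

Definition aff1 (R : realType) (n : nat) : aff R n := (0, 1%:M).

Definition affM (R : realType) (n : nat) (v w : aff R n) : aff R n :=
  (v.2 *m w.1 + v.1, v.2 *m w.2).

Definition affV (R : realType) (n : nat) (w : aff R n) : aff R n :=
  (- (invmx w.2 *m w.1), invmx w.2).

Definition transl (R : realType) (n : nat) (lam : 'cV[R]_n) : aff R n :=
  (lam, 1%:M).

Definition ext_weyl (R : realType) (n : nat) (Phi : {fset 'cV[R]_n}) :
    set (aff R n) :=
  [set w | coweight Phi w.1 /\ weyl Phi w.2].

Definition hyperplane (R : realType) (n : nat) (a : 'cV[R]_n) (k : int) :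
    set 'cV[R]_n :=
  [set x | dot x a = k%:~R].

(* The reflection x |-> x - (<x, a> - k) a^vee in the hyperplane above. *)
Definition affine_refl (R : realType) (n : nat) (a : 'cV[R]_n) (k : int) :
    aff R n :=
  (k%:~R *: coroot a, refl a).

Definition regular (R : realType) (n : nat) (Phi : {fset 'cV[R]_n}) :
    set 'cV[R]_n :=
  [set x | forall a k, a \in Phi -> ~ hyperplane a k x].

Definition alcove (R : realType) (n : nat) (Phi : {fset 'cV[R]_n})
    (C : set 'cV[R]_n) :=
  exists2 x, regular Phi x & C = connected_component (regular Phi) x.

Definition dominant_chamber (R : realType) (n : nat)
    (PhiP : {fset 'cV[R]_n}) : set 'cV[R]_n :=
  [set x | forall a, a \in PhiP -> 0 < dot x a].

Definition base_alcove (R : realType) (n : nat) (Phi PhiP : {fset 'cV[R]_n})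
    (C : set 'cV[R]_n) :=
  [/\ alcove Phi C, C `<=` dominant_chamber PhiP & closure C 0].

(* A hyperplane is a wall of C when its intersection with the closure of C
   has nonempty interior relative to the hyperplane. *)
Definition wall (R : realType) (n : nat) (C H : set 'cV[R]_n) :=
  exists2 p, H p & \forall x \near p, H x -> closure C x.

Definition S_aff (R : realType) (n : nat) (Phi : {fset 'cV[R]_n})
    (C : set 'cV[R]_n) : set (aff R n) :=
  [set s | exists a k,
     [/\ a \in Phi, wall C (hyperplane a k) & s = affine_refl a k]].

Definition word (R : realType) (n : nat) (S : set (aff R n))
    (s : seq (aff R n)) (u : aff R n) :=
  (forall x, x \in s -> S x) /\ u = foldr (@affM R n) (aff1 R n) s.

(* No inverses are needed in the words, as S_aff consists of involutions. *)
Definition W_aff (R : realType) (n : nat) (Phi : {fset 'cV[R]_n})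
    (C : set 'cV[R]_n) : set (aff R n) :=
  [set u | exists s, word (S_aff Phi C) s u].

(* The least size of a word in S_aff representing u (0 if there is none). *)
Definition aff_length (R : realType) (n : nat) (Phi : {fset 'cV[R]_n})
    (C : set 'cV[R]_n) (u : aff R n) : nat :=
  xget 0%N [set k | (exists2 s, word (S_aff Phi C) s u & size s = k) /\
                    forall s, word (S_aff Phi C) s u -> (k <= size s)%N].

(* The stabilizer of C; equivalently, the set of length-zero elements of the
   extended affine Weyl group, where the length of sigma u (sigma in Omega,
   u in W_aff) is by definition the length of u. *)
Definition Omega (R : realType) (n : nat) (Phi : {fset 'cV[R]_n})
    (C : set 'cV[R]_n) : set (aff R n) :=
  [set sigma | ext_weyl Phi sigma /\ act sigma @` C = C].

Definition aff_reflection (R : realType) (n : nat) (Phi : {fset 'cV[R]_n})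
    (C : set 'cV[R]_n) : set (aff R n) :=
  [set t | exists u s,
     [/\ W_aff Phi C u, S_aff Phi C s & t = affM (affM u s) (affV u)]].

Definition bruhat_edge (R : realType) (n : nat) (Phi : {fset 'cV[R]_n})
    (C : set 'cV[R]_n) (u t : aff R n) :=
  [/\ W_aff Phi C u, aff_reflection Phi C t &
      (aff_length Phi C u < aff_length Phi C (affM u t))%N].

(* The directed path u -> u t_1 -> u t_1 t_2 -> ... -> v of the Bruhat graph
   with edge labels ts = [:: t_1; ...; t_n]. *)
Fixpoint bruhat_path (R : realType) (n : nat) (Phi : {fset 'cV[R]_n})
    (C : set 'cV[R]_n) (u : aff R n) (ts : seq (aff R n)) (v : aff R n) :=
  if ts is t :: ts' then
    bruhat_edge Phi C u t /\ bruhat_path Phi C (affM u t) ts' v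
  else u = v.

Definition bruhat_le (R : realType) (n : nat) (Phi : {fset 'cV[R]_n})
    (C : set 'cV[R]_n) (u v : aff R n) :=
  exists ts, bruhat_path Phi C u ts v.

Definition ext_bruhat_le (R : realType) (n : nat) (Phi : {fset 'cV[R]_n})
    (C : set 'cV[R]_n) (w w' : aff R n) :=
  exists sigma u u',
    [/\ Omega Phi C sigma,
        W_aff Phi C u /\ w = affM sigma u,
        W_aff Phi C u' /\ w' = affM sigma u' &
        bruhat_le Phi C u u'].

Definition lcoset_W_aff (R : realType) (n : nat) (Phi : {fset 'cV[R]_n})
    (C : set 'cV[R]_n) (sigma : aff R n) : set (aff R n) :=
  [set affM sigma u | u in W_aff Phi C].

Definition admissible (R : realType) (n : nat) (Phi : {fset 'cV[R]_n})
    (C : set 'cV[R]_n) (mu : 'cV[R]_n) (w : aff R n) :=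
  ext_weyl Phi w /\
  exists2 A, weyl Phi A & ext_bruhat_le Phi C w (transl (A *m mu)).

(* The reflections of the finite Weyl group, as elements of the affine one. *)
Definition finite_reflection (R : realType) (n : nat)
    (Phi : {fset 'cV[R]_n}) : set (aff R n) :=
  [set t | exists2 a, a \in Phi & t = (0, refl a)].

(* Main.v *)
Require Import Defs.
From mathcomp Require Import all_boot all_order all_algebra finmap.
From mathcomp Require Import all_classical all_reals all_analysis.
From mathcomp Require Import ring.

(* Fix a point x of the base alcove C.  If H is the hyperplane of the
   reflection u t u^-1, then l(u) < l(ut) forces H not to separate C from u(C)
   (exchange condition), so x and u(0) lie on the same closed side of H and
   reflecting u(0) in H moves it strictly away from x, unless it fixes u(0).
   Hence |u(0) - x| increases along every Bruhat edge whose label moves 0.  The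
   two ends of the path have the same translation part, so no label moves 0. *)

Import Order.TTheory GRing.Theory Num.Theory.
Import numFieldNormedType.Exports.
Local Open Scope classical_set_scope.
Local Open Scope ring_scope.

(** * Euclidean geometry of reflections and the sign rules for sides of a hyperplane *)

Section Euclidean.
Set Implicit Arguments.
Unset Strict Implicit.
Variables (R : realType) (n : nat).
Implicit Types (a b x y z : 'cV[R]_n) (c : R) (u v w : aff R n).

(** The product of the last two inequalities is [p * q * r ^+ 2 >= 0], and [p * q] is negative.
    Geometrically, a point weakly on both sides of a hyperplane lies on it. *)
Lemma opposite_sides_eq0 (p q r : R) :
  p * q < 0 -> 0 <= p * r -> 0 <= q * r -> r = 0.
Proof.
move=> pq pr qr; apply/eqP; rewrite -sqrf_eq0 eq_le sqr_ge0 andbT.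
rewrite -(nmulr_rge0 _ pq).
rewrite (_ : p * q * r ^+ 2 = (p * r) * (q * r)); last by ring.
exact: mulr_ge0.
Qed.

Lemma same_side_opposite (p q r : R) :
  0 <= p * q -> p * r < 0 -> q != 0 -> q * r < 0.
Proof.
move=> pq pr q0; have p0 : p != 0.
  by apply: contraTneq pr => ->; rewrite mul0r ltxx.
have {}pq : 0 < p * q by rewrite lt0r mulf_neq0.
have p2 : 0 < p ^+ 2 by rewrite lt0r sqrf_eq0 p0 sqr_ge0.
rewrite -(pmulr_rlt0 _ p2).
rewrite (_ : p ^+ 2 * (q * r) = (p * q) * (p * r)); last by ring.
by rewrite pmulr_rlt0.
Qed.

Lemma dotE x y : dot x y = (x^T *m y) 0 0.
Proof. by rewrite mxE; apply: eq_bigr => i _; rewrite mxE. Qed.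

Lemma dotC x y : dot x y = dot y x.
Proof. by apply: eq_bigr => i _; rewrite mulrC. Qed.

Lemma dotDl x y z : dot (x + y) z = dot x z + dot y z.
Proof. by rewrite !dotE linearD mulmxDl mxE. Qed.

Lemma dotZl c x y : dot (c *: x) y = c * dot x y.
Proof. by rewrite !dotE linearZ -scalemxAl mxE. Qed.

Lemma dotDr x y z : dot z (x + y) = dot z x + dot z y.
Proof. by rewrite !(dotC z) dotDl. Qed.

Lemma dotZr c x y : dot y (c *: x) = c * dot y x.
Proof. by rewrite !(dotC y) dotZl. Qed.

Lemma dotNl x y : dot (- x) y = - dot x y.
Proof. by rewrite -scaleN1r dotZl mulN1r. Qed.

Lemma dotNr x y : dot y (- x) = - dot y x.
Proof. by rewrite !(dotC y) dotNl. Qed.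

Lemma dot0l y : dot 0 y = 0.
Proof. by rewrite -(scale0r 0) dotZl mul0r. Qed.

Definition dot_lin := (dotDl, dotDr, dotNl, dotNr, dotZl, dotZr).

Lemma dot_eq0 x : (dot x x == 0) = (x == 0).
Proof.
apply/eqP/eqP => [x0|->]; last exact: dot0l.
apply/matrixP => i j; rewrite (ord1 j) mxE; apply/eqP.
have /eqP := psumr_eq0P (fun i _ => sqr_ge0 (x i 0)) x0 (i := i) isT.
by rewrite sqrf_eq0.
Qed.

Lemma dot_gt0 x : x != 0 -> 0 < dot x x.
Proof.
by move=> x0; rewrite lt0r dot_eq0 x0 sumr_ge0// => i _; exact: sqr_ge0.
Qed.

Lemma dot_mull (A : 'M[R]_n) x y : dot (A *m x) y = dot x (A^T *m y).
Proof. by rewrite !dotE trmx_mul mulmxA. Qed.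

Lemma dot_isometry (A : 'M[R]_n) x y :
  A^T *m A = 1%:M -> dot (A *m x) (A *m y) = dot x y.
Proof. by move=> AA; rewrite dot_mull mulmxA AA mul1mx. Qed.

Lemma corootN a : coroot (- a) = - coroot a.
Proof. by rewrite /coroot !dot_lin opprK scalerN. Qed.

Lemma reflN a : refl (- a) = refl a.
Proof. by rewrite /refl corootN linearN mulmxN mulNmx opprK. Qed.

Lemma coroot_mul (A : 'M[R]_n) a :
  A^T *m A = 1%:M -> coroot (A *m a) = A *m coroot a.
Proof. by move=> AA; rewrite /coroot dot_isometry// scalemxAr. Qed.

Lemma dot_coroot a : a != 0 -> dot (coroot a) a = 2.
Proof. by move=> a0; rewrite dotZl divfK// dot_eq0. Qed.

Lemma mul_refl a x : refl a *m x = x - dot x a *: coroot a.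
Proof.
rewrite mulmxBl mul1mx -mulmxA [a^T *m x]mx11_scalar -dotE dotC.
by rewrite mul_mx_scalar.
Qed.

Lemma trmx_refl a : (refl a)^T = refl a.
Proof.
rewrite /refl raddfB /= trmx1 trmx_mul trmxK /coroot linearZ /=.
by rewrite -scalemxAl scalemxAr.
Qed.

Lemma refl_refl a : a != 0 -> refl a *m refl a = 1%:M.
Proof.
move=> a0; rewrite {2}/refl mulmxBr mulmx1 mulmxA mul_refl dot_coroot//.
by rewrite scaler_nat [_ *+ 2]mulr2n opprD addNKr mulNmx opprK subrK.
Qed.

Lemma refl_isometry a : a != 0 -> (refl a)^T *m refl a = 1%:M.
Proof. by move=> a0; rewrite trmx_refl refl_refl. Qed.

(** * Composition and conjugation of affine maps *)

Lemma affMA u v w : affM u (affM v w) = affM (affM u v) w.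
Proof. by rewrite /affM /= mulmxDr !mulmxA addrA. Qed.

Lemma aff1M u : affM (aff1 R n) u = u.
Proof. by case: u => x A; rewrite /affM /= !mul1mx addr0. Qed.

Lemma affM1 u : affM u (aff1 R n) = u.
Proof. by case: u => x A; rewrite /affM /= mulmx0 add0r mulmx1. Qed.

Lemma affMV u : u.2^T *m u.2 = 1%:M -> affM u (affV u) = aff1 R n.
Proof.
move=> /mulmx1_unit[_ uU]; rewrite /affM /= mulmxN mulmxA mulmxV// mul1mx.
by rewrite addNr.
Qed.

Lemma actM u w x : act (affM u w) x = act u (act w x).
Proof. by rewrite /act /= mulmxDr mulmxA addrA. Qed.

Lemma affine_refl_inv a (k : int) : a != 0 ->
  affM (affine_refl a k) (affine_refl a k) = aff1 R n.
Proof.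
move=> a0; rewrite /affM /= refl_refl// mul_refl dotZl dot_coroot//.
congr pair; rewrite -scalerBl -scalerDl.
by rewrite (_ : _ + _ = 0) ?scale0r//; ring.
Qed.

Lemma act_affine_refl a (k : int) x :
  act (affine_refl a k) x = x - (dot x a - k%:~R) *: coroot a.
Proof. by rewrite /act mul_refl scalerBl opprB addrA addrAC. Qed.

Lemma dot_act_affine_refl a (k : int) x b :
  dot (act (affine_refl a k) x) b =
  dot x (refl a *m b) + k%:~R * dot (coroot a) b.
Proof. by rewrite /act dotDl dotZl dot_mull trmx_refl. Qed.

(** The isometry [u] carries [hyperplane a k] onto the hyperplane with normal [u.2 *m a] and level
    [k + dot u.1 (u.2 *m a)], so it conjugates one reflection into the other; this form avoids the
    inverse of [u]. *)
Lemma affine_refl_conj u a (k m : int) : u.2^T *m u.2 = 1%:M ->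
  m%:~R = k%:~R + dot u.1 (u.2 *m a) ->
  affM u (affine_refl a k) = affM (affine_refl (u.2 *m a) m) u.
Proof.
move=> uu mE; rewrite /affM /= mul_refl mE /refl coroot_mul//; congr pair.
  rewrite -scalemxAr scalerDl addrC [k%:~R *: _ + _]addrC addrA.
  by rewrite subrK.
by rewrite mulmxBr mulmxBl mulmx1 mul1mx trmx_mul -!mulmxA uu mulmx1.
Qed.

End Euclidean.

(** * Sides of root hyperplanes relative to an alcove *)

Section Alcoves.
Set Implicit Arguments.
Unset Strict Implicit.
Variables (R : realType) (n : nat) (Phi : {fset 'cV[R]_n}) (C : set 'cV[R]_n).
Implicit Types (a b x y : 'cV[R]_n) (k m : int) (t u w : aff R n).

Lemma dot_continuous b : continuous (fun x => dot x b).
Proof.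
move=> x; rewrite /dot.
apply: (cvg_big (F := nbhs x) (@add_continuous R)) => i _.
by apply: cvgMr_tmp; exact: coord_continuous.
Qed.

Lemma alcove_regular x : alcove Phi C -> C x -> regular Phi x.
Proof. by move=> [y _ ->]; exact: connected_component_sub. Qed.

(** The image of the connected set [C] under [dot _ b] is an interval, and it misses [m] because [C]
    is regular. *)
Lemma alcove_side b m x y : alcove Phi C -> b \in Phi -> C x -> C y ->
  0 < (dot x b - m%:~R) * (dot y b - m%:~R).
Proof.
move=> Calc bPhi Cx Cy.
have Creg z : C z -> dot z b != m%:~R.
  by move=> /(alcove_regular Calc) zreg; apply/eqP; exact: zreg.
have Cint : is_interval [set dot z b | z in C].
  apply/connected_intervalP/connected_continuous_connected.
    by case: Calc => z _ ->; exact: component_connected.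
  by apply: continuous_subspaceT => z; exact: dot_continuous.
have notin : ~ [set dot z b | z in C] m%:~R by move=> [z /Creg/eqP].
case: (ltgtP (dot x b) m%:~R) (Creg x Cx) => // xm _;
  case: (ltgtP (dot y b) m%:~R) (Creg y Cy) => // ym _.
- by rewrite nmulr_lgt0 subr_lt0.
- by exfalso; apply/notin/(Cint (dot x b) (dot y b));
    [exists x|exists y|rewrite !ltW].
- by exfalso; apply/notin/(Cint (dot y b) (dot x b));
    [exists y|exists x|rewrite !ltW].
- by rewrite mulr_gt0 ?subr_gt0.
Qed.

Lemma alcove_closure_side b m x y :
  alcove Phi C -> b \in Phi -> C x -> closure C y ->
  0 <= (dot x b - m%:~R) * (dot y b - m%:~R).
Proof.
move=> Calc bPhi Cx.
pose f := fun z : 'cV[R]_n => (dot x b - m%:~R) * (dot z b - m%:~R).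
have fcont : continuous f.
  move=> z; apply: (cvgMl_tmp (F := nbhs z)).
  apply: (@cvgB _ R^o _ (nbhs z) _ (fun y => dot y b)).
    exact: dot_continuous.
  exact: cvg_cst.
have fC : C `<=` f @^-1` [set r | 0 <= r].
  by move=> z Cz; exact/ltW/(alcove_side m Calc bPhi Cx Cz).
have fcl : closed (f @^-1` [set r | 0 <= r]).
  by apply: preimage_closed; [move=> z _; exact: fcont|exact: closed_ge].
by move=> /(closureS fC); rewrite -(closure_id _).1.
Qed.

Lemma affine_reflN a k : affine_refl (- a) (- k) = affine_refl a k.
Proof. by rewrite /affine_refl reflN corootN mulrNz scaleNr scalerN opprK. Qed.

Lemma near_hyperplane_normal a b k m (p : 'cV[R]_n) :
  hyperplane a k p -> a != 0 ->
  (\forall x \near p, hyperplane a k x -> hyperplane b m x) ->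
  b = (dot b a / dot a a) *: a.
Proof.
move=> pH a0 nearH.
(* [v] is the part of [b] orthogonal to [a]. Moving from [p] along [v] stays in [hyperplane a k],
   hence for small steps in [hyperplane b m], which forces [v] to be orthogonal to [b] as well. *)
set v := b - (dot b a / dot a a) *: a.
have va : dot v a = 0 by rewrite !dot_lin divfK ?dot_eq0// subrr.
(* The punctured filter supplies a step [e] that is nonzero and can be cancelled. *)
have cv : (fun e : R => p + e *: v) @ (0 : R)^' --> p.
  apply: cvg_trans (_ : (fun e : R => p + e *: v) @ nbhs (0 : R) `=>` _).
    by apply: cvg_app; exact: nbhs_dnbhs.
  have -> : nbhs p = nbhs (p + 0 *: v) by rewrite scale0r addr0.
  by apply: cvgD; [exact: cvg_cst|apply: cvgZr_tmp; exact: cvg_id].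
have Hp : hyperplane b m p by exact: (nbhs_singleton nearH).
have [e [e0 He]] : exists e : R, e != 0 /\
    (hyperplane a k (p + e *: v) -> hyperplane b m (p + e *: v)).
  apply: (@filter_ex _ (0 : R)^'); apply: filterI; last exact: cv nearH.
  exact: (@nbhs_dnbhs_neq R 0).
have vb : dot v b = 0.
  have /He : hyperplane a k (p + e *: v).
    rewrite /hyperplane/= dotDl dotZl va mulr0 addr0; exact: pH.
  rewrite /hyperplane/= dotDl dotZl Hp => /eqP.
  by rewrite addrC -subr_eq0 addrK mulf_eq0 (negbTE e0) => /eqP.
have : v == 0 by rewrite -dot_eq0 {2}/v dotDr dotNr dotZr va vb mulr0 subr0.
by rewrite subr_eq0 => /eqP.
Qed.

(** * Walls and the exchange condition *)

Hypothesis rootPhi : root_system Phi.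
Hypothesis alcoveC : alcove Phi C.

Lemma root_neq0 a : a \in Phi -> a != 0.
Proof.
by case: rootPhi => _ Phi0 _ _ _ aPhi; apply: contraNneq Phi0 => <-.
Qed.

Lemma root_refl a b : a \in Phi -> b \in Phi -> refl a *m b \in Phi.
Proof. by case: rootPhi => _ _ + _ _; exact. Qed.

Lemma root_coroot a b :
  a \in Phi -> b \in Phi -> dot (coroot a) b \is a Num.int.
Proof. by case: rootPhi => _ _ _ + _ aPhi bPhi; rewrite dotC; exact. Qed.

(** Pulling [hyperplane b m] back along the reflection gives another root hyperplane; its level [m']
    is an integer by integrality of the root system. *)
Lemma side_affine_refl a b k m : a \in Phi -> b \in Phi ->
  exists2 m' : int, m%:~R = m'%:~R + k%:~R * dot (coroot a) b &
    forall x, dot (act (affine_refl a k) x) b - m%:~R =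
              dot x (refl a *m b) - m'%:~R.
Proof.
move=> aPhi bPhi; have /intrP[j jE] := root_coroot aPhi bPhi.
exists (m - k * j) => [|x]; first by rewrite jE -intrM -intrD subrK.
by rewrite dot_act_affine_refl jE intrB intrM opprB addrA addrC addrA addrAC.
Qed.

(** A point of the wall in the closure of [C] is fixed by the reflection, so it is weakly on the
    side of [x] and on that of its mirror image. It therefore lies on [hyperplane b m], and the two
    hyperplanes agree near a point of the wall. *)
Lemma wall_unique a b k m x : a \in Phi -> b \in Phi ->
  wall C (hyperplane a k) -> C x ->
  (dot x b - m%:~R) * (dot (act (affine_refl a k) x) b - m%:~R) < 0 ->
  affine_refl b m = affine_refl a k.
Proof.
move=> aPhi bPhi [p pH pC] Cx sep.
have a0 := root_neq0 aPhi.
have b'Phi := root_refl aPhi bPhi.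
have [m' m'm m'E] := side_affine_refl k m aPhi bPhi.
have onH q : hyperplane a k q -> closure C q -> hyperplane b m q.
  move=> qH qC; have qa : dot q a = k%:~R := qH.
  have := alcove_closure_side m alcoveC bPhi Cx qC.
  have := alcove_closure_side m' alcoveC b'Phi Cx qC.
  rewrite -!m'E [act _ q]act_affine_refl qa subrr scale0r subr0.
  by move=> BQ AQ; apply/subr0_eq/(opposite_sides_eq0 sep).
have nearH : \forall x \near p, hyperplane a k x -> hyperplane b m x.
  by apply: filterS pC => z zC zH; exact: onH (zC zH).
have bE := near_hyperplane_normal pH a0 nearH.
have pb : dot p b = m%:~R := nbhs_singleton nearH pH.
have pa : dot p a = k%:~R := pH.
set c := dot b a / dot a a in bE.
(* The root system is reduced, and the common point [p] then fixes the level up to the same sign. *)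
have [c1|c1] : c = 1 \/ c = -1.
- by case: rootPhi => _ _ _ _ /(_ a aPhi c); apply; rewrite -bE.
- by move: pb; rewrite bE c1 scale1r pa => /intr_inj ->.
- move: pb; rewrite bE c1 scaleN1r dotNr pa -mulrNz => /intr_inj <-.
  exact: affine_reflN.
Qed.

(** Induction on the word [r :: s]. If the hyperplane separates [x] from [r x], it is the wall of
    [r], and reflecting deletes [r]. Otherwise it separates [r x] from [r v x]; pulled back by [r],
    it separates [x] from [v x], and a shorter word for the reflected [v] is prefixed by [r]. *)
Lemma exchange s u b m x : C x -> b \in Phi -> word (S_aff Phi C) s u ->
  (dot x b - m%:~R) * (dot (act u x) b - m%:~R) < 0 ->
  exists2 s', word (S_aff Phi C) s' (affM (affine_refl b m) u) &
    (size s' < size s)%N.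
Proof.
move=> Cx; elim: s u b m => [|r s IHs] u b m bPhi [sS ->] /=.
  (* For the empty word the product is a square, which is not negative. *)
  by rewrite /act mul1mx addr0 -expr2 => /lt_geF; rewrite sqr_ge0.
set v := foldr _ _ _.
have [a [k [aPhi kC rE]]] : S_aff Phi C r by apply: sS; rewrite mem_head.
have sS' z : z \in s -> S_aff Phi C z.
  by move=> zs; apply: sS; rewrite inE zs orbT.
have a0 := root_neq0 aPhi.
have b'Phi := root_refl aPhi bPhi.
have [m' m'm m'E] := side_affine_refl k m aPhi bPhi.
rewrite actM.
have [sep|nsep] := ltP ((dot x b - m%:~R) * (dot (act r x) b - m%:~R)) 0.
  move=> _; exists s => //; split=> //.
  rewrite rE in sep *; rewrite (wall_unique aPhi bPhi kC Cx sep).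
  by rewrite affMA affine_refl_inv// aff1M.
rewrite rE !m'E in nsep * => sep.
have xr : dot x (refl a *m b) - m'%:~R != 0.
  by rewrite subr_eq0; apply/eqP; exact: (alcove_regular alcoveC Cx).
have sep' : (dot x (refl a *m b) - m'%:~R) *
            (dot (act v x) (refl a *m b) - m'%:~R) < 0.
  exact: same_side_opposite nsep sep xr.
have [s' [s'S s'E] lts] := IHs v _ _ b'Phi (conj sS' erefl) sep'.
exists (r :: s') => //; split.
  by move=> z; rewrite inE => /orP[/eqP ->|/s'S//]; apply: sS; rewrite mem_head.
rewrite /= -s'E rE !affMA; congr affM.
have /affine_refl_conj : (affine_refl a k).2^T *m (affine_refl a k).2 = 1%:M.
  exact: refl_isometry.
move=> /(_ (refl a *m b) m' m) /=; rewrite mulmxA refl_refl// mul1mx.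
by move=> -> //; rewrite dotZl.
Qed.

(** * Action of [W_aff] on root hyperplanes, and the length function *)

Definition preserves_roots u :=
  [/\ u.2^T *m u.2 = 1%:M,
      {in Phi, forall a, u.2 *m a \in Phi} &
      {in Phi, forall a, dot u.1 a \is a Num.int}].

Lemma preserves_roots1 : preserves_roots (aff1 R n).
Proof.
split=> [|a aPhi|a aPhi] /=; first by rewrite trmx1 mulmx1.
  by rewrite mul1mx.
by rewrite dot0l.
Qed.

(** The condition on the transpose moves [u.2] from [v.1] onto the root; for a reflection the matrix
    is symmetric. *)
Lemma preserves_rootsM u v :
  preserves_roots u -> (forall a, a \in Phi -> u.2^T *m a \in Phi) ->
  preserves_roots v -> preserves_roots (affM u v).
Proof.
move=> [uu uP uZ] uTP [vv vP vZ]; split=> [|a aPhi|a aPhi] /=.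
- by rewrite trmx_mul mulmxA -(mulmxA v.2^T) uu mulmx1.
- by rewrite -mulmxA uP ?vP.
- by rewrite dotDl dot_mull rpredD ?vZ ?uZ ?uTP.
Qed.

Lemma W_aff_preserves_roots u : W_aff Phi C u -> preserves_roots u.
Proof.
case=> s [+ ->]; elim: s => [|r s IHs] sS; first exact: preserves_roots1.
have [a [k [aPhi _ ->]]] : S_aff Phi C r by apply: sS; rewrite mem_head.
apply: preserves_rootsM => [||]; last first.
- by apply: IHs => z zs; apply: sS; rewrite inE zs orbT.
- by move=> b bPhi; rewrite trmx_refl root_refl.
- split=> [|b bPhi|b bPhi] /=; first exact/refl_isometry/root_neq0.
    exact: root_refl.
  by rewrite dotZl rpredM ?intr_int ?root_coroot.
Qed.

Lemma aff_reflectionE t : aff_reflection Phi C t ->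
  exists a k, a \in Phi /\ t = affine_refl a k.
Proof.
move=> [u [s [/W_aff_preserves_roots[uu uP uZ] [a [k [aPhi _ ->]]] ->]]].
have /intrP[j jE] := uZ _ (uP _ aPhi).
exists (u.2 *m a), (k + j); split; first exact: uP.
rewrite (affine_refl_conj (m := k + j))// ?intrD ?jE//.
by rewrite -affMA affMV// affM1.
Qed.

(** Some word represents [u], so the minimum exists and [xget] does not return its default 0. *)
Lemma aff_lengthP u : W_aff Phi C u ->
  (exists2 s, word (S_aff Phi C) s u & size s = aff_length Phi C u) /\
  (forall s, word (S_aff Phi C) s u -> (aff_length Phi C u <= size s)%N).
Proof.
move=> [s su].
pose P (k : nat) := `[<exists2 s, word (S_aff Phi C) s u & size s = k>].
have exP : exists k : nat, P k by exists (size s); apply/asboolP; exists s.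
suff : exists k : nat, (exists2 s, word (S_aff Phi C) s u & size s = k) /\
    forall s, word (S_aff Phi C) s u -> (k <= size s)%N by exact: xgetPex.
case: (ex_minnP exP) => k /asboolP Pk kmin; exists k; split=> // s' s'u.
by apply: kmin; apply/asboolP; exists s'.
Qed.

(** * Growth of the distance to a point of the base alcove *)

Hypothesis closureC0 : closure C 0.

(* If x and u(0) were on opposite sides of the hyperplane of u t u^-1, then so
   would be x and u(x), and the exchange condition would make u t shorter. *)
Lemma bruhat_edge_dist x u t : C x -> bruhat_edge Phi C u t ->
  finite_reflection Phi t \/
  dot (u.1 - x) (u.1 - x) < dot ((affM u t).1 - x) ((affM u t).1 - x).
Proof.
move=> Cx [uW /aff_reflectionE[a [k [aPhi tE]]] lt_len].
have [k0|k0] := eqVneq k 0.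
  by left; exists a => //; rewrite tE k0 /affine_refl scale0r.
right; have [uu uP uZ] := W_aff_preserves_roots uW.
set b := u.2 *m a; have bPhi : b \in Phi by exact: uP.
have /intrP[j jE] := uZ _ bPhi.
pose m := k + j.
have mE : m%:~R = k%:~R + dot u.1 b by rewrite jE intrD.
have utE : affM u t = affM (affine_refl b m) u.
  by rewrite tE (affine_refl_conj _ mE).
have bb : 0 < dot b b by exact/dot_gt0/root_neq0.
have xm : dot x b - m%:~R != 0.
  by rewrite subr_eq0; apply/eqP; exact: (alcove_regular alcoveC Cx).
have xk : dot x a - k%:~R != 0.
  by rewrite subr_eq0; apply/eqP; exact: (alcove_regular alcoveC Cx).
have kR0 : k%:~R != 0 :> R by rewrite intr_eq0.
(* As [dot u.1 b - m = - k], this says that [u(0)] and [x] lie strictly on the same side of the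
   hyperplane of [u t u^-1]. *)
have side : k%:~R * (dot x b - m%:~R) < 0.
  rewrite ltNge; apply/negP => kx.
  have := alcove_closure_side k alcoveC aPhi Cx closureC0.
  rewrite dot0l sub0r => x0.
  (* The second factor equals [dot x a - k], whose sign is opposite to that of [k] since 0 is in the
     closure of [C]. *)
  have sep : (dot x b - m%:~R) * (dot (act u x) b - m%:~R) < 0.
    rewrite /act dotDl dot_isometry// [X in _ + _ - X]mE opprD.
    rewrite addrACA subrr addr0.
    apply: same_side_opposite kx _ xm.
    rewrite mulrC lt_neqAle mulf_neq0//=.
    by rewrite -oppr_ge0 -mulrN.
  have [[s su ssize] _] := aff_lengthP uW.
  have [s' s'u] := exchange Cx bPhi su sep.
  rewrite -utE in s'u; rewrite ssize ltnNge => /negP; apply.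
  apply: leq_trans (ltnW lt_len) _.
  by apply: (aff_lengthP _).2 => //; exists s'.
have -> : (affM u t).1 - x = (u.1 - x) + (k%:~R * 2 / dot b b) *: b.
  rewrite tE /= -scalemxAr -coroot_mul// -/b /coroot scalerA mulrA.
  by rewrite [LHS]addrAC addrC addrA addrAC.
rewrite [ltRHS]dotDl !dotDr !dotZl !dotZr.
set c := _ / _; rewrite -addrA ltrDl (dotC b u.1) (dotC b (- x)) !dotDl !dotNl.
have -> : dot u.1 b = m%:~R - k%:~R by rewrite mE addrC addKr.
(* This is the gain in squared distance, positive by [side]. *)
rewrite (_ : _ + _ = - (4 / dot b b) * (k%:~R * (dot x b - m%:~R))).
  by rewrite nmulr_rgt0// oppr_lt0 divr_gt0.
by rewrite /c; field; exact: lt0r_neq0.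
Qed.

(** Finite reflections fix 0 and so keep the translation part; any other label increases the
    distance strictly, and no later edge undoes this. *)
Lemma bruhat_path_dist x u ts v : C x -> bruhat_path Phi C u ts v ->
  u.1 = v.1 /\ (forall t, t \in ts -> finite_reflection Phi t) \/
  dot (u.1 - x) (u.1 - x) < dot (v.1 - x) (v.1 - x).
Proof.
move=> Cx; elim: ts u => [|t ts IHts] u /=; first by move=> ->; left.
move=> [/(bruhat_edge_dist Cx) ut /IHts{IHts} tsv].
case: ut => [tF|ut]; last first.
  by right; case: tsv => [[<- _]|]; last exact: lt_trans.
have -> : u.1 = (affM u t).1 by case: tF => a _ -> /=; rewrite mulmx0 add0r.
case: tsv => [[uv tsF]|]; [left; split=> // z|by right].
by rewrite inE => /orP[/eqP ->|/tsF].
Qed.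

End Alcoves.

Theorem proposition4p11 (R : realType) (n : nat) (Phi PhiP : {fset 'cV[R]_n})
    (C : set 'cV[R]_n) (mu : 'cV[R]_n) (w : aff R n) :
  root_system Phi -> positive_roots Phi PhiP -> base_alcove Phi PhiP C ->
  coweight Phi mu -> dominant PhiP mu -> minuscule Phi mu ->
  admissible Phi C mu w -> ext_bruhat_le Phi C w (transl w.1) ->
  (exists sigma, [/\ Omega Phi C sigma,
      lcoset_W_aff Phi C sigma w &
      lcoset_W_aff Phi C sigma (transl w.1)]) /\
  (forall sigma, Omega Phi C sigma ->
      lcoset_W_aff Phi C sigma w ->
      lcoset_W_aff Phi C sigma (transl w.1) ->
    forall ts : seq (aff R n),
      bruhat_path Phi C (affM (affV sigma) w) ts
        (affM (affV sigma) (transl w.1)) ->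
    forall t, t \in ts -> finite_reflection Phi t).
Proof.
move=> rootPhi _ [alcoveC _ closureC0] _ _ _ _ [sigma [u [u' []]]].
move=> sigmaO [uW wE] [u'W tE] _; split.
  by exists sigma; split=> //; [exists u|exists u'].
move=> {sigma u u' sigmaO uW wE u'W tE} sigma _ _ _ ts path t tts.
have [x xreg CE] := alcoveC.
have Cx : C x by rewrite CE; exact: connected_component_refl.
(* [w] and [transl w.1] both send 0 to [w.1], so after left multiplication by [affV sigma] the
   translation parts still agree and the strict increase is absurd. *)
have [[_]|] := bruhat_path_dist rootPhi alcoveC closureC0 Cx path.
  exact.
by rewrite ltxx.
Qed.
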